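(* Let $Y$ be a cocircuit of a matroid $M$ and let $B$ be a bridge of $Y$ in $M$. Two elements $a,b\in Y$ belong to the same members of $\pi(M,B,Y)$ if and only if they belong to the same cocircuits of $M/.(B\cup Y)\backslash.Y$.
   Context: For a matroid $M$ and $X\subseteq E(M)$, the deletion to $X$ is $M\backslash.X:=M\backslash(E(M)-X)$ and the contraction to $X$ is $M/.X:=M/(E(M)-X)$. For a cocircuit $Y$ of $M$, the bridges of $Y$ in $M$ are the elementary separators (connected components) of $M\backslash Y$. For a bridge $B$ of $Y$, $\pi(M,B,Y)$ denotes the family of all minimal non-empty subsets of $Y$ that are intersections of $Y$ with cocircuits of the matroid $M/.(B\cup Y)$ (i.e. the minimal non-null subsets of $Y$ of the form $Y\cap X$ with $X$ a cocircuit of $M/.(B\cup Y)$). *)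

(* Defs.v *)
From mathcomp Require Import all_boot.

Set Implicit Arguments.
Unset Strict Implicit.
Unset Printing Implicit Defensive.

(* The ground set is a subset of an ambient finite type, so that a matroid and
   all its minors live over the same type. *)
Record matroid (T : finType) := Matroid {
  ground : {set T};
  indep : {set {set T}};
  indep_sub : forall I, I \in indep -> I \subset ground;
  indep0 : set0 \in indep;
  indep_hereditary : forall I J : {set T},
    J \in indep -> I \subset J -> I \in indep;
  indep_augment : forall I J : {set T},
    I \in indep -> J \in indep -> #|I| < #|J| ->
    exists2 e, e \in J :\: I & e |: I \in indep
}.

Section MatroidTheory.
Variable T : finType.
Implicit Types (M : matroid T) (I J X Y Z B C S : {set T}).

Definition bases M : {set {set T}} :=
  [set B | maxset [pred I | I \in indep M] B].

Definition circuits M : {set {set T}} :=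
  [set C | minset [pred D : {set T} |
                    (D \subset ground M) && (D \notin indep M)] C].

Lemma indep_extend M I J : I \in indep M -> J \in indep M -> #|I| <= #|J| ->
  exists K : {set T},
    [/\ K \in indep M, I \subset K, K \subset I :|: J & #|K| = #|J|].
Proof.
have [n] := ubnP (#|J| - #|I|); elim: n => // n IHn in I *.
move=> le_n iI iJ; rewrite leq_eqVlt => /orP[/eqP eqIJ | ltIJ].
  by exists I; rewrite subxx subsetUl.
have [e /setDP[eJ eI] ieI] := indep_augment iI iJ ltIJ.
have cI : #|e |: I| = #|I|.+1 by rewrite cardsU1 eI.
have [||K [iK sIK sKJ cK]] // := IHn (e |: I) _ ieI iJ _.
- by rewrite cI; move: le_n; rewrite -(subnSK ltIJ).
- by rewrite cI.
exists K; split=> //; first by apply: subset_trans sIK; apply: subsetUr.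
by apply: subset_trans sKJ _; rewrite -setUA subUset subxx andbT sub1set !inE eJ !orbT.
Qed.

Lemma basesP M B :
  reflect (B \in indep M /\ forall I, I \in indep M -> #|I| <= #|B|)
          (B \in bases M).
Proof.
rewrite inE; apply: (iffP maxsetP) => /= [[iB maxB] | [iB maxB]]; split=> // I iI.
  rewrite leqNgt; apply/negP => ltBI.
  have [e /setDP[_ eB] ieB] := indep_augment iB iI ltBI.
  by move: eB; rewrite -{1}(maxB _ ieB (subsetUr _ _)) setU11.
by move=> sBI; apply/esym/eqP; rewrite eqEcard sBI maxB.
Qed.

Lemma bases_neq0 M : exists B, B \in bases M.
Proof.
have [B maxB _] := @maxset_exists _ [pred I | I \in indep M] set0 (indep0 M).
by exists B; rewrite inE.
Qed.

Definition dual_indep M : {set {set T}} :=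
  [set I : {set T} | (I \subset ground M) && [exists B in bases M, [disjoint I & B]]].

Lemma dual_indep_sub M I : I \in dual_indep M -> I \subset ground M.
Proof. by rewrite inE => /andP[]. Qed.

Lemma dual_indep0 M : set0 \in dual_indep M.
Proof.
rewrite inE sub0set; have [B bB] := bases_neq0 M.
by apply/existsP; exists B; rewrite bB -setI_eq0 set0I eqxx.
Qed.

Lemma dual_indep_hereditary M I J :
  J \in dual_indep M -> I \subset J -> I \in dual_indep M.
Proof.
rewrite !inE => /andP[sJ /existsP[B /andP[bB dJB]]] sIJ.
rewrite (subset_trans sIJ sJ); apply/existsP; exists B.
by rewrite bB (disjointWl sIJ dJB).
Qed.

Lemma dual_indep_augment M I J :
  I \in dual_indep M -> J \in dual_indep M -> #|I| < #|J| ->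
  exists2 e, e \in J :\: I & e |: I \in dual_indep M.
Proof.
rewrite !inE => /andP[sI /existsP[B /andP[/basesP[iB mB] dIB]]].
move=> /andP[sJ /existsP[B' /andP[/basesP[iB' mB'] dJB']]] ltIJ.
have iB'I := indep_hereditary iB' (subsetDl B' I).
have [K [iK sK sKU cK]] := indep_extend iB'I iB (mB _ iB'I).
have bK : K \in bases M by apply/basesP; split=> // L iL; rewrite cK mB.
have dIK : [disjoint I & K].
  apply: disjointWr sKU _; rewrite -setI_eq0 setIUr (disjoint_setI0 dIB) setU0.
  by rewrite setIDA setDIl setDv set0I.
have [sJK | /subsetPn[e eJI eK]] := boolP (J :\: I \subset K); last first.
  exists e => //; move: eJI; rewrite !inE => /andP[eI eJ].
  rewrite subUset sub1set (subsetP sJ) //= sI; apply/existsP; exists K.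
  rewrite bK -setI_eq0 setIUl (disjoint_setI0 dIK) setU0 setI_eq0.
  by rewrite disjoints1.
have cKB' : #|K| = #|B'| by apply/eqP; rewrite eqn_leq mB' //= cK mB.
have dBJ : (B' :\: I) :&: (J :\: I) = set0.
  apply/setP=> x; rewrite !inE; apply/negP => /andP[/andP[_ xB'] /andP[_ xJ]].
  by rewrite (disjointFr dJB' xJ) in xB'.
have: #|(B' :\: I) :|: (J :\: I)| <= #|K| by rewrite subset_leq_card ?subUset ?sK.
rewrite cardsU dBJ cards0 subn0 cKB' -(cardsID I B') addnC leq_add2r => leJI.
have leIJ : #|B' :&: I| <= #|I :\: J|.
  apply/subset_leq_card/subsetP=> x; rewrite !inE => /andP[xB' ->].
  by rewrite (disjointFl dJB' xB').
move: ltIJ; rewrite -(cardsID J I) -(cardsID I J) setIC ltn_add2l ltnNge.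
by rewrite (leq_trans leJI leIJ).
Qed.

Definition dual M : matroid T :=
  Matroid (@dual_indep_sub M) (dual_indep0 M) (@dual_indep_hereditary M)
          (@dual_indep_augment M).

Definition cocircuits M : {set {set T}} := circuits (dual M).

Definition delete_indep M X : {set {set T}} :=
  [set I in indep M | I \subset ground M :\: X].

Lemma delete_indep_sub M X I :
  I \in delete_indep M X -> I \subset ground M :\: X.
Proof. by rewrite inE => /andP[]. Qed.

Lemma delete_indep0 M X : set0 \in delete_indep M X.
Proof. by rewrite inE indep0 sub0set. Qed.

Lemma delete_indep_hereditary M X I J :
  J \in delete_indep M X -> I \subset J -> I \in delete_indep M X.
Proof.
rewrite !inE => /andP[iJ sJ] sIJ.
by rewrite (indep_hereditary iJ sIJ) (subset_trans sIJ sJ).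
Qed.

Lemma delete_indep_augment M X I J :
  I \in delete_indep M X -> J \in delete_indep M X -> #|I| < #|J| ->
  exists2 e, e \in J :\: I & e |: I \in delete_indep M X.
Proof.
rewrite !(inE, in_set) => /andP[iI sI] /andP[iJ sJ] ltIJ.
have [e eJI ieI] := indep_augment iI iJ ltIJ; exists e => //.
rewrite inE ieI subUset sub1set sI andbT.
by apply: (subsetP sJ); case/setDP: eJI.
Qed.

Definition delete M X : matroid T :=
  Matroid (@delete_indep_sub M X) (delete_indep0 M X)
          (@delete_indep_hereditary M X) (@delete_indep_augment M X).

Definition contract M X : matroid T := dual (delete (dual M) X).

Definition delete_to M X : matroid T := delete M (ground M :\: X).

Definition contract_to M X : matroid T := contract M (ground M :\: X).

Definition separator M S : bool :=
  (S \subset ground M) &&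
  [forall C in circuits M, (C \subset S) || (C \subset ground M :\: S)].

Definition elementary_separators M : {set {set T}} :=
  [set S | minset [pred Z : {set T} | (Z != set0) && separator M Z] S].

Definition bridges M Y : {set {set T}} := elementary_separators (delete M Y).

(* The family written pi(M, B, Y) in the literature. *)
Definition bridge_family M B Y : {set {set T}} :=
  [set Z | minset
     [pred W : {set T} | (W != set0) &&
        (W \in [set Y :&: X | X in cocircuits (contract_to M (B :|: Y))])] Z].

End MatroidTheory.

(* Main.v *)
Require Import Defs.
From mathcomp Require Import all_boot.

Set Implicit Arguments.
Unset Strict Implicit.
Unset Printing Implicit Defensive.

(** For every matroid [M], the cocircuits of the restriction of [M] to [Y] are
    exactly the minimal non-empty traces on [Y] of cocircuits of [M]; applied to
    [contract_to M (B :|: Y)], this says that the two families are equal.  It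
    holds because every non-empty trace is codependent in the restriction, and
    every codependent set of the restriction contains a non-empty trace. *)

Lemma codependentP (T : finType) (M : matroid T) (D : {set T}) :
  D \subset ground M ->
  reflect (forall B, B \in bases M -> ~~ [disjoint D & B])
          (D \notin indep (dual M)).
Proof.
move=> sD; rewrite inE sD /= negb_exists.
apply: (iffP forallP) => h B; last by rewrite negb_and -implybE; apply/implyP/h.
by move: (h B); rewrite negb_and -implybE => /implyP.
Qed.

Lemma base_extend (T : finType) (M : matroid T) (I B : {set T}) :
  I \in indep M -> B \in bases M ->
  exists K : {set T}, [/\ K \in bases M, I \subset K & K \subset I :|: B].
Proof.
move=> iI /basesP[iB mB].
have [K [iK sIK sK cK]] := indep_extend iI iB (mB _ iI).
by exists K; split=> //; apply/basesP; split=> // L /mB; rewrite cK.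
Qed.

Lemma cocircuit_codependent (T : finType) (M : matroid T) (X : {set T}) :
  X \in cocircuits M -> X \subset ground M /\ X \notin indep (dual M).
Proof. by rewrite inE => /minsetp/andP. Qed.

(** Minimality of a cocircuit makes [X :\ x] independent in the dual. *)
Lemma cocircuit_base (T : finType) (M : matroid T) (X : {set T}) (x : T) :
  X \in cocircuits M -> x \in X ->
  exists2 B, B \in bases M & [disjoint X :\ x & B].
Proof.
move=> cX xX; have [sX _] := cocircuit_codependent cX.
move: cX; rewrite inE => /minsetP[_ minX].
have [] := boolP (X :\ x \in indep (dual M)).
  by rewrite inE => /andP[_ /existsP[B /andP[]]]; exists B.
move=> nX; have := minX (X :\ x).
rewrite /= (subset_trans (subsetDl _ _) sX) nX subsetDl => /(_ isT isT) eX.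
by move: xX; rewrite -eX setD11.
Qed.

Lemma codependent_cocircuit (T : finType) (M : matroid T) (D : {set T}) :
  D \subset ground M -> D \notin indep (dual M) ->
  exists2 X, X \in cocircuits M & X \subset D.
Proof.
move=> sD nD.
have [|X minX sX] := @minset_exists _
  [pred D : {set T} | (D \subset ground (dual M)) && (D \notin indep (dual M))] D.
  by rewrite /= sD.
by exists X => //; rewrite inE.
Qed.

Lemma ground_delete_to (T : finType) (M : matroid T) (Y : {set T}) :
  ground (delete_to M Y) = ground M :&: Y.
Proof. by rewrite /= setDDr setDv set0U. Qed.

Lemma indep_delete_to (T : finType) (M : matroid T) (Y I : {set T}) :
  (I \in indep (delete_to M Y)) = (I \in indep M) && (I \subset ground M :&: Y).
Proof. by rewrite inE setDDr setDv set0U. Qed.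

(** Otherwise a base [B0] of the restriction avoids the trace, and it can be extended to a base of
    [M] that avoids all of [X]. *)
Lemma trace_codependent (T : finType) (M : matroid T) (Y X : {set T}) :
  X \in cocircuits M -> Y :&: X != set0 ->
  Y :&: X \notin indep (dual (delete_to M Y)).
Proof.
move=> cX /set0Pn[x /setIP[xY xX]].
have [sX nX] := cocircuit_codependent cX.
have sYX : Y :&: X \subset ground (delete_to M Y).
  by rewrite ground_delete_to setIC setSI.
apply/codependentP => // B0 /basesP[iB0 mB0]; apply/negP => dB0.
have := iB0; rewrite indep_delete_to => /andP[jB0 sB0].
(* Extending [B0] from a base that meets [X] at most in [x] leaves [x] as the only element of [X]
   that [K] could contain. *)
have [B1 bB1 dB1] := cocircuit_base cX xX.
have [K [bK sK sKU]] := base_extend jB0 bB1.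
have [iK _] := elimT (basesP _ _) bK.
have xB0 : x \notin B0 by rewrite (disjointFr dB0) // inE xY.
(* Since [x] lies in [Y], having it in [K] would let [B0] grow inside the restriction. *)
have xK : x \notin K.
  apply/negP => xK; have : x |: B0 \in indep (delete_to M Y).
    rewrite indep_delete_to (indep_hereditary iK) ?subUset ?sub1set ?xK //=.
    by rewrite sB0 inE xY (subsetP sX).
  by move/mB0; rewrite cardsU1 xB0 ltnn.
have /negP[] := elimT (codependentP sX) nX K bK.
rewrite -setI_eq0; apply/set0Pn => -[z /setIP[zX zK]].
have /setUP[zB0 | zB1] := subsetP sKU z zK.
  have /setIP[_ zY] := subsetP sB0 z zB0.
  by move: zB0; rewrite (disjointFr dB0) // inE zY.
have zx : z != x by apply: contraNneq xK => <-.
by move: zB1; rewrite (disjointFr dB1) // !inE zx.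
Qed.

Lemma codependent_trace (T : finType) (M : matroid T) (Y D : {set T}) :
  D \subset ground (delete_to M Y) -> D \notin indep (dual (delete_to M Y)) ->
  exists X, [/\ X \in cocircuits M, Y :&: X != set0 & Y :&: X \subset D].
Proof.
move=> sD nD; have dep := elimT (codependentP sD) nD.
have [B0 bB0] := bases_neq0 (delete_to M Y).
have [iB0 mB0] := elimT (basesP _ _) bB0.
have := iB0; rewrite indep_delete_to => /andP[jB0 sB0].
have [B1 bB1] := bases_neq0 M.
(* Extending [B0] makes [B] meet [Y] in as many elements as a base can; this drives the counting
   below. *)
have [B [bB sB _]] := base_extend jB0 bB1.
move: sD; rewrite ground_delete_to => sD.
have sDM : D \subset ground M := subset_trans sD (subsetIl _ _).
have [_ mB] := elimT (basesP _ _) bB.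
(* The part of [Z] outside [Y] avoids the base [B], so a cocircuit inside [Z]
   has to meet [D]. *)
pose Z := D :|: (ground M :\: Y) :\: B.
have sZ : Z \subset ground M.
  rewrite subUset sDM; apply: subset_trans (subsetDl _ _) (subsetDl _ _).
have nZ : Z \notin indep (dual M).
  apply/codependentP => // K bK; apply/negP => dK.
  have [iK mK] := elimT (basesP _ _) bK; have sKM := indep_sub iK.
  have iKY : K :&: Y \in indep (delete_to M Y).
    by rewrite indep_delete_to (indep_hereditary iK) ?subsetIl // setSI.
  (* [K :&: Y] avoids [D], so it cannot be a base of the restriction. *)
  have ltK : #|K :&: Y| < #|B0|.
    rewrite ltnNge; apply/negP => leB.
    have /dep/negP[] : K :&: Y \in bases (delete_to M Y).
      by apply/basesP; split=> // L /mB0 /leq_trans; apply.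
    rewrite disjoint_sym; apply: disjointWl (subsetIl _ _) _.
    by rewrite disjoint_sym; apply: disjointWl dK; apply: subsetUl.
  have leK : #|K :\: Y| <= #|B :\: Y|.
    apply/subset_leq_card/subsetP => z /setDP[zK zY]; rewrite inE zY /=.
    have zM := subsetP sKM z zK; apply: contraLR zK => zB.
    by rewrite (disjointFr dK) // !inE zB zY zM orbT.
  have leB0 : #|B0| <= #|B :&: Y|.
    by rewrite subset_leq_card // subsetI sB (subset_trans sB0) ?subsetIr.
  have [iB _] := elimT (basesP _ _) bB.
  (* [K] is strictly smaller than [B] inside [Y] and no larger outside, yet both are bases. *)
  have := mK _ iB; rewrite -(cardsID Y K) -(cardsID Y B) leqNgt.
  by rewrite -addSn leq_add // (leq_trans ltK).
have [X cX sXZ] := codependent_cocircuit sZ nZ.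
have [sX nX] := cocircuit_codependent cX.
exists X; split=> //.
  (* [X] meets [B], and the only elements of [Z] in [B] come from [D], hence lie in [Y]. *)
  have := elimT (codependentP sX) nX B bB; rewrite -setI_eq0.
  case/set0Pn => z /setIP[zX zB]; apply/set0Pn; exists z; rewrite inE zX andbT.
  have := subsetP sXZ z zX; rewrite !inE zB /= orbF => /(subsetP sD).
  by case/setIP.
apply/subsetP => z /setIP[zY /(subsetP sXZ)].
by rewrite !inE zY /= andbF orbF.
Qed.

Lemma cocircuits_delete_to (T : finType) (M : matroid T) (Y : {set T}) :
  cocircuits (delete_to M Y) =
  [set Z | minset [pred W : {set T} | (W != set0) &&
                     (W \in [set Y :&: X | X in cocircuits M])] Z].
Proof.
set Q := [pred W : {set T} | _ && _].
pose P := [pred D : {set T} | (D \subset ground (dual (delete_to M Y))) &&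
                              (D \notin indep (dual (delete_to M Y)))].
have QP W : Q W -> P W.
  case/andP=> W0 /imsetP[X cX eW]; move: W0; rewrite eW => W0.
  have [sX _] := cocircuit_codependent cX.
  apply/andP; split; last exact: trace_codependent.
  by rewrite [ground _]ground_delete_to setIC setSI.
have PQ D : P D -> exists2 W, Q W & W \subset D.
  case/andP=> sD nD; have [X [cX nX sXD]] := codependent_trace sD nD.
  by exists (Y :&: X); rewrite //= nX; apply/imsetP; exists X.
apply/setP=> Z; rewrite !inE -/P; apply/minsetP/minsetP => -[hZ minZ].
  (* The trace [W] inside a [P]-minimal [Z] is itself in [P], so it equals [Z]. *)
  have [W qW sW] := PQ _ hZ; have eW := minZ _ (QP _ qW) sW.
  by rewrite -{1}eW; split=> // V /QP; apply: minZ.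
(* Conversely, [V] is squeezed between [Z] and a trace [W], which equals [Z] by minimality. *)
split=> [|V /PQ[W qW sW] sV]; first exact: QP.
by apply/eqP; rewrite eqEsubset sV -(minZ W qW (subset_trans sW sV)).
Qed.

Theorem theorem3p1 (T : finType) (M : matroid T) (Y B : {set T})
    (hY : Y \in cocircuits M) (hB : B \in bridges M Y)
    (a b : T) (ha : a \in Y) (hb : b \in Y) :
  (forall Z : {set T}, Z \in bridge_family M B Y -> (a \in Z) = (b \in Z)) <->
  (forall Z : {set T},
     Z \in cocircuits (delete_to (contract_to M (B :|: Y)) Y) ->
     (a \in Z) = (b \in Z)).
Proof. by rewrite cocircuits_delete_to. Qed.
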